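(* Let $0<\alpha\le1$, let $\theta=(k_r)$ be a lacunary sequence, let $A=(a_{mk})$ be an infinite matrix of complex numbers and let $\mathscr{M}=(M_k)$ be a Musielak-Orlicz function satisfying the $\Delta_2$-condition. Then $\hat N_\theta^\alpha(A)\subset\hat N_\theta^\alpha(A,\mathscr{M})$.
   Context: A lacunary sequence is an increasing integer sequence $\theta=(k_r)_{r\ge 0}$ with $k_0=0$ and $h_r=k_r-k_{r-1}\to\infty$ as $r\to\infty$. Put $I_r=(k_{r-1},k_r]$ (the integers in this interval), and write $h_r^\alpha=(h_r)^\alpha$. An Orlicz function is a function $M:[0,\infty)\to[0,\infty)$ that is continuous, non-decreasing and convex with $M(0)=0$, $M(x)>0$ for $x>0$ and $M(x)\to\infty$ as $x\to\infty$. A Musielak-Orlicz function is a sequence $\mathscr{M}=(M_k)_{k\ge1}$ of Orlicz functions. It satisfies the $\Delta_2$-condition if there exist constants $a,K>0$ and a sequence $c=(c_k)_{k=1}^\infty\in\ell^1_+$ (the positive cone of $\ell^1$) such that $M_k(2u)\le K M_k(u)+c_k$ for all $k\in\mathbb{N}$ and $u\in\mathbb{R}_+$ whenever $M_k(u)\le a$. For a sequence $x=(x_k)$ of complex numbers, $A_n(x)=\sum_{k=1}^\infty a_{nk}x_k$ (only sequences $x$ for which all these series converge are considered). For a sequence $y=(y_j)$, $t_{km}(y)=\frac{y_m+y_{m+1}+\dots+y_{m+k}}{k+1}$. The notation $t_{km}(A_k(x)-L)$ means $t_{km}$ applied to the sequence $(A_j(x)-L)_j$, i.e. $\frac{1}{k+1}\sum_{i=0}^{k}(A_{m+i}(x)-L)$.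 $\hat N_\theta^\alpha(A)$ is the set of all $x=(x_k)$ for which there is a number $L$ with $\lim_{r\to\infty}\frac{1}{h_r^\alpha}\sum_{k\in I_r}|t_{km}(A_k(x)-L)|=0$ uniformly in $m$. $\hat N_\theta^\alpha(A,\mathscr{M})$ is the set of all $x=(x_k)$ for which there are a number $L$ and positive numbers $\rho^{(k)}>0$ ($k\ge1$) such that $$\lim_{r\to\infty}\frac{1}{h_r^\alpha}\sum_{k\in I_r}M_k\left(\frac{|t_{km}(A_k(x)-L)|}{\rho^{(k)}}\right)=0\quad\text{uniformly in } m.$$ *)

(* Defs.v *)
From Stdlib Require Import Reals.
From Coquelicot Require Import Coquelicot.
Open Scope R_scope.

(* Sequences and matrices are indexed by the positive integers: they are
   functions on nat whose values at index 0 are never used. *)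

Definition hr (theta : nat -> nat) (r : nat) : nat :=
  (theta r - theta (r - 1))%nat.

Definition lacunary (theta : nat -> nat) : Prop :=
  theta 0%nat = 0%nat /\
  (forall r : nat, (theta r < theta (S r))%nat) /\
  is_lim_seq (fun r => INR (hr theta r)) p_infty.

(* Only the values on [0, +oo) matter. *)
Definition Orlicz (M : R -> R) : Prop :=
  (forall u, 0 <= u -> 0 <= M u) /\
  continuous_on (fun u => 0 <= u) M /\
  (forall u v, 0 <= u -> u <= v -> M u <= M v) /\
  (forall u v t, 0 <= u -> 0 <= v -> 0 <= t <= 1 ->
     M (t * u + (1 - t) * v) <= t * M u + (1 - t) * M v) /\
  M 0 = 0 /\
  (forall u, 0 < u -> 0 < M u) /\
  is_lim M p_infty p_infty.

Definition Musielak_Orlicz (M : nat -> R -> R) : Prop :=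
  forall k : nat, (1 <= k)%nat -> Orlicz (M k).

Definition l1_pos (c : nat -> R) : Prop :=
  (forall k : nat, (1 <= k)%nat -> 0 <= c k) /\ ex_series (fun k => c (S k)).

Definition Delta2 (M : nat -> R -> R) : Prop :=
  exists (a K : R) (c : nat -> R), 0 < a /\ 0 < K /\ l1_pos c /\
  forall (k : nat) (u : R), (1 <= k)%nat -> 0 <= u ->
    M k u <= a -> M k (2 * u) <= K * M k u + c k.

Definition Aterm (A : nat -> nat -> C) (x : nat -> C) (n k : nat) : C :=
  Cmult (A n (S k)) (x (S k)).

Definition Aconv (A : nat -> nat -> C) (x : nat -> C) : Prop :=
  forall n : nat, (1 <= n)%nat ->
    ex_series (K := C_AbsRing) (V := C_NormedModule) (Aterm A x n).

(* Meaningful when the series converges: iota selects its unique sum. *)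
Definition Atrans (A : nat -> nat -> C) (x : nat -> C) (n : nat) : C :=
  iota (T := C_CompleteNormedModule)
    (is_series (K := C_AbsRing) (V := C_NormedModule) (Aterm A x n)).

Lemma Atrans_correct (A : nat -> nat -> C) (x : nat -> C) (n : nat) :
  Aconv A x -> (1 <= n)%nat ->
  is_series (K := C_AbsRing) (V := C_NormedModule) (Aterm A x n) (Atrans A x n).
Proof.
intros H Hn; destruct (H n Hn) as [l Hl].
pose proof (iota_filterlim_locally (K := C_AbsRing) (V := C_CompleteNormedModule)
  (F := eventually) (sum_n (G := C_AbelianMonoid) (Aterm A x n)) l Hl) as E.
assert (E' : Atrans A x n = l) by exact E.
rewrite E'; exact Hl.
Qed.

Definition tkm (k m : nat) (y : nat -> C) : C :=
  Cdiv (sum_n (G := C_AbelianMonoid) (fun i => y (m + i)%nat) k)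
       (RtoC (INR (k + 1))).

(* (1 / h_r^alpha) * sum_{k in I_r} f k, with I_r = (k_{r-1}, k_r] *)
Definition lac_mean (theta : nat -> nat) (alpha : R) (f : nat -> R) (r : nat) : R :=
  / Rpower (INR (hr theta r)) alpha
  * sum_n_m f (S (theta (r - 1)%nat)) (theta r).

(* g r m tends to 0 as r -> oo, uniformly in m >= 1 *)
Definition unif_lim0 (g : nat -> nat -> R) : Prop :=
  forall eps : R, 0 < eps ->
    exists r0 : nat, forall r m : nat, (r0 <= r)%nat -> (1 <= m)%nat ->
      Rabs (g r m) < eps.

Definition Nhat (theta : nat -> nat) (alpha : R) (A : nat -> nat -> C)
    (x : nat -> C) : Prop :=
  Aconv A x /\
  exists L : C,
    unif_lim0 (fun r m =>
      lac_mean theta alpha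
        (fun k => Cmod (tkm k m (fun j => Cminus (Atrans A x j) L))) r).

Definition NhatM (theta : nat -> nat) (alpha : R) (A : nat -> nat -> C)
    (M : nat -> R -> R) (x : nat -> C) : Prop :=
  Aconv A x /\
  exists (L : C) (rho : nat -> R),
    (forall k : nat, (1 <= k)%nat -> 0 < rho k) /\
    unif_lim0 (fun r m =>
      lac_mean theta alpha
        (fun k => M k (Cmod (tkm k m (fun j => Cminus (Atrans A x j) L)) / rho k)) r).

(* Main.v *)
Require Import Defs.
From Stdlib Require Import Reals Lra Lia.
From Coquelicot Require Import Coquelicot.
Open Scope R_scope.

(** The numbers [rho k] may depend on [k], and this freedom carries the proof.
    Write [t k m] for the modulus of the [k]-th mean started at [m].

    Strong summability of [x] to [L] makes, for all large [r] and uniformly in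
    [m], the sum of [t k m] over the block [I_r] at most [h_r ^ alpha]; each
    single term therefore is at most [h_r ^ alpha <= h_r <= theta r]
    ([term_le_hr]).  Since [theta] is strictly increasing, an index [k] of
    [I_r] satisfies [r <= k], so [t k m <= theta k]: a bound that depends on
    [k] only.

    Convexity and [M k 0 = 0] give [M k s <= s * M k 1] for [0 <= s <= 1]
    ([Orlicz_div_le]).  A number [rho k] that exceeds [theta k] brings
    [t k m / rho k] into [[0, 1]], and an extra factor [1 + M k 1] absorbs the
    slope: then [M k (t k m / rho k) <= t k m].  The means that define the
    Musielak-Orlicz space are thus dominated, from some [r] on and for every
    [m], by those that are known to tend to [0]. *)

Lemma sum_n_m_le_loc (f g : nat -> R) (n m : nat) :
  (forall k, (n <= k <= m)%nat -> f k <= g k) ->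
  sum_n_m f n m <= sum_n_m g n m.
Proof.
intros H.
rewrite (sum_n_m_ext_loc f (fun k => Rmin (f k) (g k))).
- apply sum_n_m_le; intros k; apply Rmin_r.
- intros k Hk; rewrite Rmin_left; [reflexivity | exact (H k Hk)].
Qed.

Lemma sum_n_m_ge0 (f : nat -> R) (n m : nat) :
  (forall k, (n <= k <= m)%nat -> 0 <= f k) -> 0 <= sum_n_m f n m.
Proof.
intros H.
replace 0 with (sum_n_m (fun _ : nat => 0) n m).
- now apply sum_n_m_le_loc.
- exact (sum_n_m_const_zero (G := R_AbelianMonoid) n m).
Qed.

Lemma term_le_sum_n_m (f : nat -> R) (n m k : nat) :
  (forall j, (n <= j <= m)%nat -> 0 <= f j) -> (n <= k <= m)%nat ->
  f k <= sum_n_m f n m.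
Proof.
induction m as [|m IH]; intros H Hk.
- replace n with 0%nat by lia; replace k with 0%nat by lia.
  rewrite sum_n_n; apply Rle_refl.
- rewrite sum_n_Sm by lia; change plus with Rplus.
  destruct (Nat.eq_dec k (S m)) as [->|Hne].
  + assert (0 <= sum_n_m f n m) by (apply sum_n_m_ge0; intros; apply H; lia).
    lra.
  + assert (f k <= sum_n_m f n m) by (apply IH; [intros; apply H|]; lia).
    assert (0 <= f (S m)) by (apply H; lia).
    lra.
Qed.

Lemma lac_mean_le (theta : nat -> nat) (alpha : R) (f g : nat -> R) (r : nat) :
  (forall k, (S (theta (r - 1)) <= k <= theta r)%nat -> f k <= g k) ->
  lac_mean theta alpha f r <= lac_mean theta alpha g r.
Proof.
intros H; apply Rmult_le_compat_l.
- apply Rlt_le, Rinv_0_lt_compat, exp_pos.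
- now apply sum_n_m_le_loc.
Qed.

Lemma lac_mean_ge0 (theta : nat -> nat) (alpha : R) (f : nat -> R) (r : nat) :
  (forall k, (S (theta (r - 1)) <= k <= theta r)%nat -> 0 <= f k) ->
  0 <= lac_mean theta alpha f r.
Proof.
intros H; apply Rmult_le_pos.
- apply Rlt_le, Rinv_0_lt_compat, exp_pos.
- now apply sum_n_m_ge0.
Qed.

(** Dropping the other terms of the block leaves [f k <= h_r ^ alpha], and
    [alpha <= 1] together with [1 <= h_r] removes the exponent. *)
Lemma term_le_hr (theta : nat -> nat) (alpha : R) (f : nat -> R) (r k : nat) :
  alpha <= 1 -> (1 <= hr theta r)%nat -> (forall j, 0 <= f j) ->
  lac_mean theta alpha f r <= 1 ->
  (S (theta (r - 1)) <= k <= theta r)%nat ->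
  f k <= INR (hr theta r).
Proof.
intros Ha Hh Hf H1 Hk.
assert (Hh1 : 1 <= INR (hr theta r)) by (change 1 with (INR 1); now apply le_INR).
assert (Hp : 0 < Rpower (INR (hr theta r)) alpha) by apply exp_pos.
assert (Hpow : Rpower (INR (hr theta r)) alpha <= INR (hr theta r)).
{ rewrite <- (Rpower_1 (INR (hr theta r))) at 2 by lra.
  now apply Rle_Rpower. }
assert (Hfk : f k <= sum_n_m f (S (theta (r - 1)%nat)) (theta r))
  by (apply term_le_sum_n_m; auto).
unfold lac_mean in H1.
apply (Rmult_le_compat_l _ _ _ (Rlt_le _ _ Hp)) in H1.
rewrite <- Rmult_assoc, Rinv_r in H1 by lra.
lra.
Qed.

(** [t / rho] lies in [[0, 1]], where convexity keeps the graph of [N] below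
    the chord from [(0, 0)] to [(1, N 1)]; the slope [N 1] is then cancelled by
    the factor [1 + N 1] of [rho]. *)
Lemma Orlicz_div_le (N : R -> R) (t T : R) :
  Orlicz N -> 0 <= t <= T -> N (t / ((1 + N 1) * (1 + T))) <= t.
Proof.
intros (Hpos & _ & _ & Hconv & H0 & _) [Ht HtT].
assert (HN : 0 <= N 1) by (apply Hpos; lra).
set (rho := (1 + N 1) * (1 + T)).
assert (Hrho1 : 1 + N 1 <= rho) by (unfold rho; nra).
assert (Hrho2 : t <= rho) by (unfold rho; nra).
assert (Hs0 : 0 <= t / rho) by (apply Rdiv_le_0_compat; lra).
assert (Hs1 : t / rho <= 1) by (apply Rle_div_l; lra).
assert (Hchord : N (t / rho) <= t / rho * N 1).
{ pose proof (Hconv 1 0 (t / rho) Rle_0_1 (Rle_refl 0) (conj Hs0 Hs1)) as Hc.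
  rewrite H0 in Hc.
  replace (t / rho * 1 + (1 - t / rho) * 0) with (t / rho) in Hc by ring.
  lra. }
assert (Hback : t / rho * rho = t) by (field; lra).
nra.
Qed.

Lemma lacunary_ge_id (theta : nat -> nat) (r : nat) :
  lacunary theta -> (r <= theta r)%nat.
Proof.
intros (_ & Hs & _); induction r as [|r IH]; [lia|].
specialize (Hs r); lia.
Qed.

Lemma lacunary_mono (theta : nat -> nat) (i j : nat) :
  lacunary theta -> (i <= j)%nat -> (theta i <= theta j)%nat.
Proof.
intros (_ & Hs & _) Hij; induction Hij as [|j Hij IH]; [lia|].
specialize (Hs j); lia.
Qed.

(** The right-hand side is free of [r], which lets one number [rho k] serve
    every block. *)
Lemma hr_le_theta (theta : nat -> nat) (r k : nat) :
  lacunary theta -> (S (theta (r - 1)) <= k)%nat -> (hr theta r <= theta k)%nat.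
Proof.
intros Hth Hk.
pose proof (lacunary_ge_id theta (r - 1) Hth).
assert (theta r <= theta k)%nat by (apply lacunary_mono; [assumption | lia]).
unfold hr; lia.
Qed.

Theorem theorem3p5 (alpha : R) (theta : nat -> nat) (A : nat -> nat -> C)
    (M : nat -> R -> R) :
  0 < alpha <= 1 ->
  lacunary theta ->
  Musielak_Orlicz M ->
  Delta2 M ->
  forall x : nat -> C, Nhat theta alpha A x -> NhatM theta alpha A M x.
Proof.
intros [_ Ha] Hth HM _ x [HA [L HL]].
split; [exact HA|].
exists L, (fun k => (1 + M k 1) * (1 + INR (theta k))).
assert (Hrho : forall k, (1 <= k)%nat -> 0 < (1 + M k 1) * (1 + INR (theta k))).
{ intros k Hk.
  pose proof (proj1 (HM k Hk) 1 Rle_0_1).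
  pose proof (pos_INR (theta k)).
  apply Rmult_lt_0_compat; lra. }
split; [exact Hrho|].
intros eps Heps.
destruct (HL 1 Rlt_0_1) as [r1 Hr1].
destruct (HL eps Heps) as [r2 Hr2].
(* The bound [1 <= r] excludes the empty block at [r = 0], where [hr] is 0. *)
exists (S (r1 + r2)); intros r m Hr Hm.
specialize (Hr1 r m ltac:(lia) Hm).
specialize (Hr2 r m ltac:(lia) Hm).
cbv beta in Hr1, Hr2 |- *.
set (t := fun k => Cmod (tkm k m (fun j => Cminus (Atrans A x j) L))) in *.
assert (Ht : forall k, 0 <= t k) by (intros k; apply Cmod_ge_0).
assert (Hh : (1 <= hr theta r)%nat).
{ pose proof (proj1 (proj2 Hth) (r - 1)%nat) as Hs.
  replace (S (r - 1)) with r in Hs by lia.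
  unfold hr; lia. }
assert (Hbound : forall k, (S (theta (r - 1)) <= k <= theta r)%nat ->
                 t k <= INR (theta k)).
{ intros k Hk.
  apply Rle_trans with (INR (hr theta r)).
  - apply (term_le_hr theta alpha); auto.
    apply Rabs_def2 in Hr1; lra.
  - apply le_INR, hr_le_theta; [exact Hth | lia]. }
rewrite Rabs_pos_eq.
- apply Rle_lt_trans with (lac_mean theta alpha t r).
  + apply lac_mean_le; intros k Hk.
    apply (Orlicz_div_le (M k) (t k)); [apply HM; lia | auto].
  + apply Rabs_def2 in Hr2; lra.
- apply lac_mean_ge0; intros k Hk.
  apply (proj1 (HM k ltac:(lia))), Rdiv_le_0_compat; [apply Ht | apply Hrho; lia].
Qed.
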